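(* A $\mathbb{Z}$-module $M$ is weakly uniserial with ${\rm Soc}(M) \neq 0$ if and only if $M \cong \mathbb{Z}_{p^{n}}$ or $M \cong \mathbb{Z}_{p^{\infty}}$ or $M \cong \bigoplus_{I} \mathbb{Z}_{p}$, for some prime number $p$, some integer $n \geq 1$, and some nonempty index set $I$.
   Context: A module $M$ is called weakly uniserial if for any two submodules $N$ and $K$ of $M$ there exists an injective module homomorphism $N\to K$ or an injective module homomorphism $K\to N$. ${\rm Soc}(M)$ denotes the socle of $M$, $\mathbb{Z}_m=\mathbb{Z}/m\mathbb{Z}$, and $\mathbb{Z}_{p^\infty}$ is the Prüfer $p$-group. *)

(* Defs.v *)
From HB Require Import structures.
From mathcomp Require Import all_boot all_order all_algebra.
From mathcomp Require Import boolp classical_sets.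
From mathcomp Require Import generic_quotient ring_quotient.
From mathcomp.multinomials Require Import monalg.

Set Implicit Arguments.
Unset Strict Implicit.
Unset Printing Implicit Defensive.

Import GRing.Theory Num.Theory.

Local Open Scope ring_scope.

Section Modules.

Variable R : nzRingType.

(* Submodules are the structures [submodClosed M], whose carriers are boolean
   predicates on [M]; by [boolp.asbool] every subset of [M] is of that form. *)

Definition submodule_type (M : lmodType R) (N : submodClosed M) : Type :=
  {x : M | x \in N}.

HB.instance Definition _ (M : lmodType R) (N : submodClosed M) :=
  SubChoice.on (submodule_type N).
HB.instance Definition _ (M : lmodType R) (N : submodClosed M) :=
  [SubChoice_isSubLmodule of submodule_type N by <:].

Definition embeds (U V : lmodType R) : Prop :=
  exists f : {linear U -> V}, injective f.

Definition isomorphic (U V : lmodType R) : Prop :=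
  exists f : {linear U -> V}, bijective f.

Definition weakly_uniserial (M : lmodType R) : Prop :=
  forall N K : submodClosed M,
    embeds (submodule_type N) (submodule_type K) \/
    embeds (submodule_type K) (submodule_type N).

Definition simple_submodule (M : lmodType R) (N : submodClosed M) : Prop :=
  (exists2 x, x \in N & x != 0) /\
  forall K : submodClosed M, {subset K <= N} -> K =i pred1 0 \/ K =i N.

(* The sum of all simple submodules: finite sums of elements each lying in
   some simple submodule. *)
Definition socle (M : lmodType R) : set M :=
  [set x | exists2 s : seq M,
     forall y, y \in s ->
       exists2 N : submodClosed M, simple_submodule N & y \in N &
     x = \sum_(y <- s) y].

End Modules.

Arguments socle {R} M _.

(* For p prime, [zinv p] is Z[1/p]: the rationals whose reduced denominator is
   a power of p.  The Pruefer p-group is the quotient Z[1/p] / Z. *)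

Definition zinv_pred (p : nat) : {pred rat} :=
  fun x => p.-nat `|denq x|%N.

Fact zinv_zmod_closed (p : nat) : zmod_closed (zinv_pred p).
Proof.
split=> [|x y]; rewrite !unfold_in /zinv_pred // => xp yp.
have xyp : p.-nat (`|denq x| * `|denq y|)%N by rewrite pnatM xp.
apply: pnat_dvd xyp.
have : x - y = (numq x * denq y - numq y * denq x)%:~R / (denq x * denq y)%:~R.
  rewrite -{1}[x]divq_num_den -{1}[y]divq_num_den -mulNr addf_div ?intr_eq0 ?denq_neq0 //.
  by rewrite mulNr rmorphB !rmorphM.
move=> ->; set n := (_ - _ : int); set d := denq x * denq y.
have d0 : d != 0 by rewrite mulf_neq0 ?denq_neq0.
rewrite -abszM -/d -[X in (_ %| X)%N]/(`|d|%N).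
by case: (divqP n d) d0 => // k z k0 _; rewrite abszM dvdn_mull.
Qed.

HB.instance Definition _ (p : nat) :=
  GRing.isZmodClosed.Build rat (zinv_pred p) (zinv_zmod_closed p).

Definition zinv (p : nat) : Type := {x : rat | x \in zinv_pred p}.

HB.instance Definition _ (p : nat) := SubChoice.on (zinv p).
HB.instance Definition _ (p : nat) := [SubChoice_isSubZmodule of zinv p by <:].

Definition zinv_int (p : nat) : {pred zinv p} :=
  fun x => val x \is a Num.int.

Fact zinv_int_zmod_closed (p : nat) : zmod_closed (@zinv_int p).
Proof.
split=> [|x y]; rewrite !unfold_in /zinv_int ?(raddf0 val) // => xZ yZ.
by rewrite (raddfB val); exact: rpredB.
Qed.

HB.instance Definition _ (p : nat) :=
  GRing.isZmodClosed.Build (zinv p) (@zinv_int p) (@zinv_int_zmod_closed p).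

Definition prufer (p : nat) : zmodType := Quotient.quot (@zinv_int p).

(* Main.v *)
Require Import Defs.
From HB Require Import structures.
From mathcomp Require Import all_boot all_order all_algebra.
From mathcomp Require Import boolp classical_sets.
From mathcomp Require Import generic_quotient ring_quotient finmap.
From mathcomp.multinomials Require Import monalg.
From mathcomp Require Import zify.

(* A nonzero socle contains an element x of prime order p.  Comparing the cyclic
   submodule of x with the other cyclic submodules shows that M is a p-group.
   If p M <> 0, pick u of order p^2; the p-torsion M[p] and Z u are comparable,
   and as Z u does not embed in M[p], M[p] embeds in Z u and hence has order p.
   So an element whose order is at least that of z generates z: M is cyclic when
   its exponent is finite, and otherwise p-divisible with M[p] of order p, i.e.
   Pruefer.  If p M = 0, M is a vector space over F_p and has a basis.
   Conversely the submodules of a cyclic or Pruefer p-group form a chain, and for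
   two subspaces N, K of an F_p-space a maximal isomorphism between subspaces of N
   and K exhausts N or K.

   Homomorphisms are obtained from their graphs: a subgroup of U x V with trivial
   kernels on both sides, and total on U, is the graph of an injective map. *)

Set Implicit Arguments.
Unset Strict Implicit.
Unset Printing Implicit Defensive.

Import GRing.Theory Num.Theory.

Local Open Scope classical_set_scope.
Local Open Scope ring_scope.
Local Open Scope quotient_scope.

(** * Subgroups and graphs of homomorphisms *)

Lemma scaleintE (M : lmodType int) (a : int) (x : M) : a *: x = x *~ a.
Proof. by rewrite -scaler_int intz. Qed.

Definition is_subgroup (V : zmodType) (P : set V) : Prop :=
  P 0 /\ forall x y, P x -> P y -> P (x - y).

Section Subgroup.
Variables (V : zmodType) (P : set V).
Hypothesis Pc : is_subgroup P.

Lemma subgroupN x : P x -> P (- x).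
Proof. by case: Pc => P0 PB Px; rewrite -sub0r; apply: PB. Qed.

Lemma subgroupD x y : P x -> P y -> P (x + y).
Proof. by move=> Px Py; rewrite -[y]opprK; apply: (Pc.2) => //; apply: subgroupN. Qed.

Lemma subgroupMn x n : P x -> P (x *+ n).
Proof.
move=> Px; elim: n => [|n IH]; first by rewrite mulr0n; case: Pc.
by rewrite mulrS; apply: subgroupD.
Qed.

Lemma subgroupMz x n : P x -> P (x *~ n).
Proof.
by move=> Px; case: n => n; rewrite ?NegzE ?mulrNz; [|apply: subgroupN]; apply: subgroupMn.
Qed.

End Subgroup.

(** Scaling by an integer is iterated addition up to sign, so a subgroup is already a submodule;
    [asboolP] turns its carrier into a boolean predicate. *)
Lemma submodule_of_subgroup (M : lmodType int) (P : set M) : is_subgroup P ->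
  exists N : submodClosed M, forall x, x \in N <-> P x.
Proof.
move=> [P0 PB]; pose b := fun x : M => `[< P x >].
have cl : submod_closed (b : {pred M}).
  split=> [|a x y]; first exact/asboolP.
  move=> /asboolP Px /asboolP Py; apply/asboolP; rewrite scaleintE.
  have Pc : is_subgroup P by [].
  exact: (subgroupD Pc) (subgroupMz Pc _ Px) Py.
pose m := GRing.isSubmodClosed.Build int M b cl.
pose N : submodClosed M := HB.pack_for (submodClosed M) b m.
exists N => x; split; first by move=> h; apply/asboolP; exact: h.
by move=> h; have : b x by apply/asboolP.
Qed.

(** Any choice of values is additive: [f (w - z)] and [f w - f z] are both related to [w - z], so
    their difference is related to 0 and vanishes. *)
Lemma embeds_of_graph (U V : lmodType int) (G : U -> V -> Prop) :
  (forall u v u' v', G u v -> G u' v' -> G (u - u') (v - v')) ->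
  (forall u, exists v, G u v) ->
  (forall v, G 0 v -> v = 0) -> (forall u, G u 0 -> u = 0) ->
  exists2 f : {linear U -> V}, injective f & forall u, G u (f u).
Proof.
move=> GB /choice[f Gf] G0 Gk.
have lf : linear f.
  move=> a x y.
  have fD u v : f (u + v) = f u + f v.
    have fB w z : f (w - z) = f w - f z.
      apply/eqP; rewrite -subr_eq0; apply/eqP/G0.
      by rewrite -[0](subrr (w - z)); apply: (GB _ _ _ _) => //; apply: GB.
    have f0 : f 0 = 0 by apply: G0.
    by rewrite -[v in LHS]opprK fB -sub0r fB f0 sub0r opprK.
  have f0 : f 0 = 0 by apply: G0.
  have fN u : f (- u) = - f u.
    by apply/eqP; rewrite -subr_eq0 opprK -fD addNr f0.
  rewrite fD !scaleintE; congr (_ + _).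
  have fMn n : f (x *+ n) = f x *+ n.
    by elim: n => [|n IH]; rewrite ?mulr0n // !mulrS fD IH.
  by case: a => n; rewrite ?NegzE ?mulrNz ?fN -?pmulrn fMn.
pose m := GRing.isLinear.Build int U V _ f lf.
pose F : {linear U -> V} := HB.pack_for {linear U -> V} f m.
exists F => // x y exy; apply/eqP; rewrite -subr_eq0; apply/eqP/Gk.
by have := GB _ _ _ _ (Gf x) (Gf y); rewrite -[f x]/(F x) exy subrr.
Qed.

Lemma isomorphic_of_graph (U V : lmodType int) (G : U -> V -> Prop) :
  (forall u v u' v', G u v -> G u' v' -> G (u - u') (v - v')) ->
  (forall u, exists v, G u v) -> (forall v, exists u, G u v) ->
  (forall v, G 0 v -> v = 0) -> (forall u, G u 0 -> u = 0) ->
  isomorphic U V.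
Proof.
move=> GB Gl /choice[g Gg] G0 Gk.
have [f fi Gf] := embeds_of_graph GB Gl G0 Gk.
exists f; exists g => x; apply/eqP; rewrite -subr_eq0; apply/eqP.
  by apply: Gk; have := GB _ _ _ _ (Gg (f x)) (Gf x); rewrite subrr.
by apply: G0; have := GB _ _ _ _ (Gf (g x)) (Gg x); rewrite subrr.
Qed.

(** An injective homomorphism between subgroups, kept as a map of the ambient group constrained on
    [P] only, which avoids subtypes. *)
Definition monic_on (V : zmodType) (P Q : set V) (g : V -> V) : Prop :=
  [/\ forall x, P x -> Q (g x),
      forall x, P x -> g x = 0 -> x = 0,
      forall x y, P x -> P y -> g (x - y) = g x - g y &
      forall x n, P x -> g (x *~ n) = g x *~ n].

Lemma embeds_monic (M : lmodType int) (N K : submodClosed M) :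
  embeds (submodule_type N) (submodule_type K) ->
  exists g, monic_on [set x | x \in N] [set x | x \in K] g.
Proof.
case=> f fi; pose g x := if insub x is Some u then val (f u) else 0.
have gE (u : submodule_type N) : g (val u) = val (f u).
  by rewrite /g valK.
exists g; split=> /=.
- move=> x xN; rewrite -[x]/(val (Sub x xN : submodule_type N)) gE.
  exact: (valP (f _)).
- move=> x xN; rewrite -[x]/(val (Sub x xN : submodule_type N)) gE => h.
  have : f (Sub x xN) = 0 by apply/val_inj; rewrite h raddf0.
  by move/eqP; rewrite raddf_eq0 // => /eqP->; rewrite raddf0.
- move=> x y xN yN; rewrite -[x]/(val (Sub x xN : submodule_type N)).
  by rewrite -[y]/(val (Sub y yN : submodule_type N)) -raddfB !gE !raddfB.
- move=> x n xN; rewrite -[x]/(val (Sub x xN : submodule_type N)).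
  by rewrite -raddfMz !gE !raddfMz.
Qed.

Lemma weakly_uniserial_monic (M : lmodType int) (P Q : set M) :
  weakly_uniserial M -> is_subgroup P -> is_subgroup Q ->
  exists g, monic_on P Q g \/ monic_on Q P g.
Proof.
move=> Mw /submodule_of_subgroup[N NP] /submodule_of_subgroup[K KQ].
have eN : [set x | x \in N] = P by apply/seteqP; split=> x /NP.
have eK : [set x | x \in K] = Q by apply/seteqP; split=> x /KQ.
by have [/embeds_monic[g]|/embeds_monic[g]] := Mw N K; rewrite eN eK; exists g; [left|right].
Qed.

Definition multiples (V : zmodType) (x : V) : set V := [set y | exists a, y = x *~ a].

Lemma multiples_self (V : zmodType) (z : V) : multiples z z.
Proof. by exists 1. Qed.

Lemma multiples_subgroup (V : zmodType) (x : V) : is_subgroup (multiples x).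
Proof.
split; first by exists 0; rewrite mulr0z.
by move=> _ _ [a ->] [b ->]; exists (a - b); rewrite mulrzBr.
Qed.

(** * Weakly uniserial modules *)

Lemma submod_mulrz (M : lmodType int) (N : submodClosed M) (n : int) (x : M) :
  x \in N -> x *~ n \in N.
Proof. by move=> xN; rewrite -scaleintE rpredZ. Qed.

(** Apply a Bezout relation between [a] and [b] to [x]: the term in [b] dies. *)
Lemma Bezout_mulrz (V : zmodType) (x : V) (a b : int) :
  x *~ b = 0 -> exists u, x *~ a *~ u = x *~ (gcdz a b).
Proof.
move=> xb; have [u [v e]] := Bezoutz a b; exists u.
by rewrite -e mulrzDr [v * b]mulrC (mulrzA x b v) xb mul0rz addr0 -mulrzA mulrC.
Qed.

(** An integer is zero or invertible modulo [p]. *)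
Lemma mulrz_prime (V : zmodType) (p : nat) (x : V) (n : int) :
  prime p -> x *+ p = 0 -> (p %| n)%Z \/ exists u, x *~ n *~ u = x.
Proof.
move=> pp xp; have [|pn] := boolP (p %| n)%Z; [by left|right].
have xp' : x *~ p = 0 by rewrite -pmulrn.
have [u e] := Bezout_mulrz n xp'; exists u; rewrite e.
rewrite /gcdz absz_nat (_ : gcdn _ _ = 1)%N //.
by apply/eqP; rewrite -[_ == _]/(coprime `|n| p) coprime_sym prime_coprime.
Qed.

Lemma mulrz_dvd0 (V : zmodType) (p : nat) (x : V) (n : int) :
  x *+ p = 0 -> (p %| n)%Z -> x *~ n = 0.
Proof. by move=> xp /dvdzP[k ->]; rewrite mulrC mulrzA -pmulrn xp mul0rz. Qed.

(** The gcd of [a] and [p ^ n] is some [p ^ i], so [g *~ a] and [g *+ p ^ i] generate the same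
    subgroup. *)
Lemma mulrz_pexp (V : zmodType) (p n : nat) (g : V) (a : int) :
  prime p -> g *+ p ^ n = 0 ->
  exists i c u, g *~ a = g *+ p ^ i *~ c /\ g *+ p ^ i = g *~ a *~ u.
Proof.
move=> pp gn; have gn' : g *~ (p ^ n)%N = 0 by rewrite -pmulrn.
have [u e] := Bezout_mulrz a gn'.
have /(dvdn_pfactor _ _ pp)[i _ ei] : (gcdn `|a| (p ^ n) %| p ^ n)%N by apply: dvdn_gcdr.
have : (gcdz a (p ^ n)%N %| a)%Z by apply: dvdz_gcdl.
rewrite {1}/gcdz absz_nat ei => /dvdzP[c ea].
exists i, c, u; rewrite e /gcdz absz_nat ei -pmulrn; split=> //.
by rewrite {1}ea mulrC mulrzA -pmulrn.
Qed.

(** By [mulrz_pexp] each of the two subgroups is generated by some [g *+ p ^ i], and these are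
    nested. *)
Lemma cyclic_multiples_chain (V : zmodType) (p n : nat) (g : V) (a b : int) :
  prime p -> g *+ p ^ n = 0 ->
  multiples (g *~ a) (g *~ b) \/ multiples (g *~ b) (g *~ a).
Proof.
move=> pp gn; wlog suff H : a b / forall i c u j d v,
    g *~ a = g *+ p ^ i *~ c -> g *+ p ^ i = g *~ a *~ u ->
    g *~ b = g *+ p ^ j *~ d -> g *+ p ^ j = g *~ b *~ v ->
    (i <= j)%N -> multiples (g *~ a) (g *~ b).
  have [i [c [u [ea eu]]]] := mulrz_pexp a pp gn.
  have [j [d [v [eb ev]]]] := mulrz_pexp b pp gn.
  have [ij|/ltnW ij] := leqP i j; [left|right].
    exact: H ea eu eb ev ij.
  exact: H eb ev ea eu ij.
move=> i c u j d v ea eu eb ev ij; exists (u * (p ^ (j - i))%N * d).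
by rewrite !mulrzA -eu -pmulrn -mulrnA -expnD subnKC.
Qed.

(** All submodules then form a chain under inclusion: if [x] lies in [N] but not in [K], no [y] in
    [K] has [x] as a multiple, so every such [y] is a multiple of [x] and lies in [N]. *)
Lemma chain_weakly_uniserial (M : lmodType int) :
  (forall x y : M, multiples x y \/ multiples y x) -> weakly_uniserial M.
Proof.
move=> Mc; have incl (N K : submodClosed M) : {subset N <= K} ->
    embeds (submodule_type N) (submodule_type K).
  move=> NK; pose G (u : submodule_type N) (v : submodule_type K) := val u = val v.
  have [] := @embeds_of_graph (submodule_type N) (submodule_type K) G.
  - by move=> u v u' v' e e'; rewrite /G !raddfB; congr (_ - _).
  - by move=> u; exists (Sub (val u) (NK _ (valP u))).
  - by move=> v; rewrite /G raddf0 => e; apply/val_inj; rewrite raddf0 -e.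
  - by move=> v; rewrite /G raddf0 => e; apply/val_inj; rewrite raddf0 e.
  by move=> f fi _; exists f.
move=> N K; have [NK|nNK] := pselect {subset N <= K}; [by left; apply: incl|right].
apply: incl => y yK; move/existsNP: nNK => [x /not_implyP[xN xK]].
have [[a ->]|[a e]] := Mc x y; first by rewrite submod_mulrz.
by case: xK; rewrite e submod_mulrz.
Qed.

(** The submodule generated by [x] is simple: a nonzero multiple of [x] has a multiple equal to [x],
    by invertibility modulo [p]. *)
Lemma order_p_socle (M : lmodType int) (p : nat) (x : M) :
  prime p -> x != 0 -> x *+ p = 0 -> socle M <> [set 0].
Proof.
move=> pp x0 xp; have [N NP] := submodule_of_subgroup (multiples_subgroup x).
have xN : x \in N by apply/NP; exists 1.
suff : socle M x by move=> /[swap] -> /eqP; rewrite (negPf x0).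
exists [:: x]; rewrite ?big_seq1 // => y; rewrite inE => /eqP->.
exists N => //; split; first by exists x.
move=> K KN; have [[k kK k0]|K0] := pselect (exists2 k, k \in K & k != 0).
  right; have /NP[n ek] := KN _ kK.
  have [/(mulrz_dvd0 xp) e|[u e]] := mulrz_prime n pp xp.
    by move: k0; rewrite ek e eqxx.
  move=> z; apply/idP/idP => [/KN //|/NP[b ->]].
  by rewrite -e -ek !submod_mulrz.
left=> z; rewrite inE; apply/idP/eqP => [zK|->]; last exact: rpred0.
by apply/eqP; apply: contra_notT K0 => z0; exists z.
Qed.

(* [G] may be empty: [Zorn_bigcup] also takes the union of the empty chain. *)
Definition partial_iso (V : zmodType) (N K : {pred V}) (G : set (V * V)) : Prop :=
  [/\ forall w, G w -> (w.1 \in N) && (w.2 \in K),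
      forall w w', G w -> G w' -> G (w.1 - w'.1, w.2 - w'.2),
      forall y, G (0, y) -> y = 0 &
      forall x, G (x, 0) -> x = 0].

Lemma elementary_weakly_uniserial (M : lmodType int) (p : nat) :
  prime p -> (forall x : M, x *+ p = 0) -> weakly_uniserial M.
Proof.
move=> pp Mp N K.
have [F Fiso FT|G [[GNK GB G0 Gk] Gmax]] := @Zorn_bigcup (M * M)%type (partial_iso N K).
  split=> [w [X XF Xw]|w w' [X XF Xw] [Y YF Yw]|y [X XF Xw]|x [X XF Xw]].
  - by case: (Fiso _ XF) => /(_ _ Xw).
  - have [XY|YX] := FT _ _ XF YF.
      by exists Y => //; case: (Fiso _ YF) => _ /(_ _ _ (XY _ Xw) Yw).
    by exists X => //; case: (Fiso _ XF) => _ /(_ _ _ Xw (YX _ Yw)).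
  - by case: (Fiso _ XF) => _ _ /(_ _ Xw).
  - by case: (Fiso _ XF) => _ _ _ /(_ _ Xw).
(* Otherwise [G], being closed under differences, would be empty and properly contained in the zero
   isomorphism. *)
have G00 : G (0, 0).
  apply: contrapT => nG; apply: (Gmax [set (0, 0)]); last first.
    split=> [w ->|w w' -> ->|y [->]|x [->]] //=; first by rewrite !rpred0.
    by rewrite subrr.
  split; last by move=> /(_ (0, 0)) h; apply/nG/h.
  by move=> w Gw; case: nG; have := GB _ _ Gw Gw; rewrite !subrr.
have [dN|nN] := pselect (forall x, x \in N -> exists y, G (x, y)).
  left; have [] := @embeds_of_graph (submodule_type N) (submodule_type K)
     (fun u v => G (val u, val v)).
  - by move=> u v u' v' /GB /[apply]; rewrite !raddfB.
  - move=> u; have [y Gy] := dN _ (valP u).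
    by have /andP[_ /= yK] := GNK _ Gy; exists (Sub y yK).
  - by move=> v; rewrite raddf0 => /G0 e; apply/val_inj; rewrite raddf0.
  - by move=> v; rewrite raddf0 => /Gk e; apply/val_inj; rewrite raddf0.
  by move=> f fi _; exists f.
have [dK|nK] := pselect (forall y, y \in K -> exists x, G (x, y)).
  right; have [] := @embeds_of_graph (submodule_type K) (submodule_type N)
     (fun u v => G (val v, val u)).
  - by move=> u v u' v' /GB /[apply]; rewrite !raddfB.
  - move=> u; have [y Gy] := dK _ (valP u).
    by have /andP[/= yN _] := GNK _ Gy; exists (Sub y yN).
  - by move=> v; rewrite raddf0 => /Gk e; apply/val_inj; rewrite raddf0.
  - by move=> v; rewrite raddf0 => /G0 e; apply/val_inj; rewrite raddf0.
  by move=> f fi _; exists f.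
move/existsNP: nN => [x /not_implyP[xN nx]].
move/existsNP: nK => [y /not_implyP[yK ny]].
(* [x] lies outside the domain of [G] and [y] outside its image; adjoining the pair [(x, y)]
   contradicts maximality. *)
pose G' := [set w | exists w' n, G w' /\ w = (w'.1 + x *~ n, w'.2 + y *~ n)].
exfalso; apply: (Gmax G').
  split; first by move=> w Gw; exists w, 0; rewrite !mulr0z !addr0; case: w Gw.
  move=> /(_ (x, y)) G'G; apply: nx; exists y; apply: G'G.
  by exists (0, 0), 1; rewrite !add0r.
have Gmz w n : G w -> G (w.1 *~ n, w.2 *~ n).
  move=> Gw; have Gc : @is_subgroup (M * M)%type G by split=> // w1 w2; apply: GB.
  have := subgroupMz Gc n Gw; suff -> : w *~ n = (w.1 *~ n, w.2 *~ n) by [].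
  by rewrite -(raddfMz fst) -(raddfMz snd) -surjective_pairing.
split.
- move=> w [[a b] [n [Gw ->]]] /=; have /andP[/= aN bK] := GNK _ Gw.
  by rewrite !rpredD ?submod_mulrz.
- move=> _ _ [w [n [Gw ->]]] [w' [n' [Gw' ->]]].
  exists (w.1 - w'.1, w.2 - w'.2), (n - n'); split; first exact: GB.
  by rewrite /= !mulrzBr !opprD; congr pair; rewrite addrACA.
- move=> z [[a b] [n [Gw [/= e ->]]]].
  have ea : a = x *~ (- n) by apply/eqP; rewrite mulrNz -addr_eq0 -e.
  (* Either [p] divides [n] and the added multiples of [x] and [y] vanish, or [x] is a multiple of
     [a] and so lies in the domain of [G]. *)
  have [pn|[u eu]] := mulrz_prime (- n) pp (Mp x).
    have yn : y *~ n = 0 by rewrite -[n]opprK mulrNz (mulrz_dvd0 (Mp y) pn) oppr0.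
    by move: Gw; rewrite yn addr0 ea (mulrz_dvd0 (Mp x) pn) => /G0.
  by case: nx; exists (b *~ u); rewrite -eu -ea; apply: (Gmz (a, b)).
- move=> z [[a b] [n [Gw [/= -> e]]]].
  have eb : b = y *~ (- n) by apply/eqP; rewrite mulrNz -addr_eq0 -e.
  have [pn|[u eu]] := mulrz_prime (- n) pp (Mp y).
    have xn : x *~ n = 0 by rewrite -[n]opprK mulrNz (mulrz_dvd0 (Mp x) pn) oppr0.
    by move: Gw; rewrite xn addr0 eb (mulrz_dvd0 (Mp y) pn) => /Gk.
  by case: ny; exists (a *~ u); rewrite -eu -eb; apply: (Gmz (a, b)).
Qed.

(** * Torsion and the socle of a weakly uniserial module *)

Lemma mulrn_absz (V : zmodType) (x : V) (n : int) : x *~ n = 0 -> x *+ `|n|%N = 0.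
Proof.
move=> xn; rewrite pmulrn abszEsg mulrC mulrzA xn; exact: mul0rz.
Qed.

Lemma coprime_mulrn_eq0 (V : zmodType) (x : V) (a b : nat) :
  coprime a b -> x *+ a = 0 -> x *+ b = 0 -> x = 0.
Proof.
move=> /eqP ab xa xb; have xb' : x *~ b = 0 by rewrite -pmulrn.
have [u] := Bezout_mulrz a xb'.
by rewrite -pmulrn xa mul0rz /gcdz !absz_nat ab => ->.
Qed.

(** Remove prime factors from [m] one at a time until the multiple of [y] becomes nonzero; the last
    prime removed is [q]. That [q] divides [m] later separates it from [p]. *)
Lemma finite_order_prime (V : zmodType) (y : V) (m : nat) :
  (0 < m)%N -> y != 0 -> y *+ m = 0 ->
  exists q k, [/\ prime q, (q %| m)%N, y *+ k != 0 & y *+ k *+ q = 0].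
Proof.
elim/ltn_ind: m => m IH m0 y0 ym.
have m1 : (1 < m)%N by case: m m0 ym {IH} => [|[|//]] // _ /eqP; rewrite mulr1n (negPf y0).
have pq := pdiv_prime m1; have qm := pdiv_dvd m.
have [e|ne] := eqVneq (y *+ (m %/ pdiv m)) 0; last first.
  by exists (pdiv m), (m %/ pdiv m)%N; rewrite -mulrnA divnK.
have lt : (m %/ pdiv m < m)%N by rewrite ltn_Pdiv // prime_gt1.
have gt : (0 < m %/ pdiv m)%N by rewrite divn_gt0 ?prime_gt0 // dvdn_leq.
have [q [k [? qd ? ?]]] := IH _ lt gt y0 e.
by exists q, k; split=> //; rewrite (dvdn_trans qd) // dvdn_div.
Qed.

(** Doubling detects torsion: for a nonzero [y] in a simple [N], the multiples of [y *+ 2] form 0 or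
    [N]. In the second case [y] equals [y *~ (2 * a)], so the odd, hence nonzero, integer
    [2 * a - 1] kills [y]. *)
Lemma socle_order_p (M : lmodType int) : socle M <> [set 0] ->
  exists p (x : M), [/\ prime p, x != 0 & x *+ p = 0].
Proof.
move=> sM; have [y [N [y0 Nsimple yN]]] : exists y (N : submodClosed M),
    [/\ y != 0, simple_submodule N & y \in N].
  apply: contrapT => nex; apply: sM; apply/seteqP; split=> [_ [s sP ->]|_ ->] /=; last first.
    by exists [::]; rewrite ?big_nil.
  rewrite big1_seq // => y /andP[_ /sP[N Ns yN]]; apply/eqP.
  by apply: contra_notT nex => y0; exists y, N.
suff [n n0 yn] : exists2 n, (0 < n)%N & y *+ n = 0.
  have [q [k [pq _ ? ?]]] := finite_order_prime n0 y0 yn.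
  by exists q, (y *+ k).
have [K KP] := submodule_of_subgroup (multiples_subgroup (y *+ 2)).
have KN : {subset K <= N}.
  by move=> _ /KP[a ->]; apply: submod_mulrz; rewrite pmulrn; apply: submod_mulrz.
have [e|e] := Nsimple.2 K KN.
  exists 2%N => //; have : y *+ 2 \in K by apply/KP; exists 1.
  by rewrite e inE => /eqP.
have : y \in K by rewrite e.
move=> /KP[a ya]; pose n : int := 2 * a - 1.
exists `|n|%N; first by rewrite absz_gt0 /n; lia.
by apply: mulrn_absz; rewrite mulrzBr mulrzA -pmulrn -ya subrr.
Qed.

Lemma monic_on0 (V : zmodType) (P Q : set V) (g : V -> V) (x : V) :
  monic_on P Q g -> P x -> g 0 = 0.
Proof. by move=> [_ _ gB _] Px; rewrite -[X in g X](subrr x) gB // subrr. Qed.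

Section WeaklyUniserial.
Variables (M : lmodType int) (p : nat) (x : M).
Hypotheses (Mw : weakly_uniserial M) (pp : prime p) (x0 : x != 0) (xp : x *+ p = 0).

(** [g a] is killed by the prime that kills [a] and, as a multiple of [b], by the one that kills
    [b]. The disjunction serves both directions of comparison. *)
Lemma monic_order_primes (q : nat) (a b : M) g : prime q -> q != p ->
  (a *+ p = 0 /\ b *+ q = 0 \/ a *+ q = 0 /\ b *+ p = 0) ->
  monic_on (multiples a) (multiples b) g -> a = 0.
Proof.
move=> pq qp ab gm; have [gP gi _ gz] := gm; have aa := multiples_self a.
apply: gi => //; have [c ec] := gP _ aa.
have gn n : a *+ n = 0 -> g a *+ n = 0.
  by move=> an; rewrite pmulrn -gz // -pmulrn an (monic_on0 gm aa).
have bn n : b *+ n = 0 -> g a *+ n = 0.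
  by move=> bn; rewrite ec pmulrn -mulrzA mulrC mulrzA -pmulrn bn mul0rz.
have pq' : coprime p q by rewrite prime_coprime // dvdn_prime2 // eq_sym.
by case: ab => [[/gn + /bn]|[/gn + /bn]] => [h1 h2|h2 h1]; apply: coprime_mulrn_eq0 pq' h1 h2.
Qed.

(** Compare the multiples of [x] and of [y]. If [x] goes to [y *~ c], then [c] is nonzero and
    [c * p] kills [y]; if [y] goes to a multiple of [x], then [p] kills [y]. *)
Lemma finite_order (y : M) : exists2 m, (0 < m)%N & y *+ m = 0.
Proof.
have [y0|y0] := eqVneq y 0; first by exists 1%N.
have absN n : n != 0 -> y *~ n = 0 -> exists2 m, (0 < m)%N & y *+ m = 0.
  move=> n0 yn; exists `|n|%N; first by rewrite absz_gt0.
  exact: mulrn_absz.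
have p0 : (p : int) != 0 by rewrite -lt0n prime_gt0.
have xx := multiples_self x; have yy := multiples_self y.
have [g [gm|gm]] :=
  weakly_uniserial_monic Mw (multiples_subgroup x) (multiples_subgroup y).
all: have [gP gi _ gz] := gm.
- have [c ec] := gP _ xx; apply: (absN (c * p)); last first.
    by rewrite mulrzA -ec -gz // -pmulrn xp (monic_on0 gm xx).
  rewrite mulf_neq0 //; apply: (contra_neq _ x0) => c0; apply: gi => //.
  by rewrite ec c0.
- have [c ec] := gP _ yy; apply: (absN p) => //; apply: gi.
    by exists p.
  by rewrite gz // ec -mulrzA mulrC mulrzA -pmulrn xp mul0rz.
Qed.

(** Let [w] be [y] times the [p]-part of its order. If [w] were nonzero, some multiple of it would
    have prime order [q] other than [p], and could not be compared with [x]. *)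
Lemma p_torsion (y : M) : exists k, y *+ p ^ k = 0.
Proof.
have [m m0 ym] := finite_order y.
have [m' pm' em] := pfactor_coprime pp m0; exists (logn p m).
apply/eqP; apply: contraT => w0; set w := y *+ _ in w0.
have wm : w *+ m' = 0 by rewrite -mulrnA mulnC -em.
have m'0 : (0 < m')%N by move: m0; rewrite em muln_gt0 => /andP[].
have [q [k [pq qm z0 zq]]] := finite_order_prime m'0 w0 wm.
have qp : q != p.
  by apply: contraTneq qm => ->; rewrite -prime_coprime.
have [g [gm|gm]] :=
  weakly_uniserial_monic Mw (multiples_subgroup x) (multiples_subgroup (w *+ k)).
- have e := monic_order_primes pq qp (or_introl (conj xp zq)) gm.
  by move: (x0); rewrite e eqxx.
- have e := monic_order_primes pq qp (or_intror (conj zq xp)) gm.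
  by rewrite e eqxx in z0.
Qed.

Lemma p_torsion_part_cyclic (u z : M) :
  u *+ p != 0 -> u *+ p *+ p = 0 -> z *+ p = 0 -> multiples (u *+ p) z.
Proof.
move=> up0 upp zp.
have Nc : is_subgroup [set w : M | w *+ p = 0].
  by split=> [|a b] /=; rewrite ?mul0rn // mulrnBl => -> ->; rewrite subrr.
have uu := multiples_self u; have upu : multiples u (u *+ p) by exists p; rewrite pmulrn.
have [g [gm|[gP gi _ gz]]] :=
  weakly_uniserial_monic Mw Nc (multiples_subgroup u); last first.
  have /= := gP _ uu; rewrite pmulrn -gz // -pmulrn => /(gi _ upu) e.
  by rewrite e eqxx in up0.
have [gP gi gB gz] := gm; have g0 : g 0 = 0 := monic_on0 gm Nc.1.
(* The image consists of [p]-torsion in the multiples of [u]: if [g w] is [u *~ a], then [a] kills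
   [u *+ p], which forces [p] to divide [a]. *)
have im w : w *+ p = 0 -> multiples (u *+ p) (g w).
  move=> wp; have [a ea] := gP _ wp.
  have : u *~ (a * p) = 0 by rewrite mulrzA -ea -gz // -pmulrn wp g0.
  have [/dvdzP[b eb] _|[v ev]] := mulrz_prime a pp upp.
    by exists b; rewrite ea eb mulrC mulrzA -pmulrn.
  move=> h; have : u *+ p *~ a = 0 by rewrite pmulrn -mulrzA mulrC.
  by move=> h'; move: up0; rewrite -ev h' mul0rz eqxx.
set t := u *+ p in upp up0 im *.
have [a ea] := im _ upp; have [b eb] := im _ zp.
have [pa|[v ev]] := mulrz_prime a pp upp.
  have e : t = 0 by apply: gi => //; rewrite ea (mulrz_dvd0 upp pa).
  by rewrite e eqxx in up0.
(* [v] inverts [a] modulo [p], so [g] sends [t *~ (v * b)] to [t *~ b], which is [g z]. *)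
exists (v * b); apply/eqP; rewrite -subr_eq0; apply/eqP.
have tz n : t *~ n *+ p = 0 by rewrite pmulrn -mulrzA mulrC mulrzA -pmulrn upp mul0rz.
apply: gi; first by rewrite /= mulrnBl zp tz subrr.
by rewrite gB //= ?gz // ea eb -mulrzA mulrA mulrzA [in X in _ - X]mulrzA ev subrr.
Qed.

End WeaklyUniserial.

(** * Abelian p-groups whose p-torsion is generated by one element *)

Section Cocyclic.
Variables (V : zmodType) (p : nat) (x : V).
Hypotheses (pp : prime p) (x0 : x != 0) (xp : x *+ p = 0).
Hypothesis Vp : forall y : V, exists k, y *+ p ^ k = 0.
Hypothesis Vx : forall z : V, z *+ p = 0 -> multiples x z.

Lemma multiples_order_p (y z : V) :
  y != 0 -> y *+ p = 0 -> z *+ p = 0 -> multiples y z.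
Proof.
move=> y0 /Vx[a ea] /Vx[c ->].
have [pa|[b eb]] := mulrz_prime a pp xp.
  by rewrite ea (mulrz_dvd0 xp pa) eqxx in y0.
by exists (b * c); rewrite mulrzA ea eb.
Qed.

(** Induction on the order: some [y *~ c] agrees with [z] after multiplication by the top power of
    [p], so [z - y *~ c] has smaller order and the induction hypothesis makes it a multiple of
    [y *+ p]. *)
Lemma multiples_exact_order (k : nat) (y z : V) : y *+ p ^ k != 0 ->
  y *+ p ^ k.+1 = 0 -> z *+ p ^ k.+1 = 0 -> multiples y z.
Proof.
elim: k y z => [|k IH] y z yk yk1 zk1.
  by move: yk yk1 zk1; rewrite expn0 expn1 mulr1n; apply: multiples_order_p.
have ykp : y *+ p ^ k.+1 *+ p = 0 by rewrite -mulrnA -expnSr.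
have zkp : z *+ p ^ k.+1 *+ p = 0 by rewrite -mulrnA -expnSr.
have [c e] := multiples_order_p yk ykp zkp.
have [|||d ed] := IH (y *+ p) (z - y *~ c).
- by rewrite -mulrnA -expnS.
- by rewrite -mulrnA -expnS.
- by rewrite mulrnBl e !pmulrn -!mulrzA [_ * c]mulrC subrr.
exists (p%:Z * d + c); rewrite mulrzDr mulrzA -pmulrn -ed subrK //.
Qed.

Lemma exact_order (y : V) (k : nat) : y *+ p ^ k != 0 ->
  exists2 j, (k <= j)%N & y *+ p ^ j != 0 /\ y *+ p ^ j.+1 = 0.
Proof.
move=> yk; have ex : exists n, y *+ p ^ n == 0 by have [n e] := Vp y; exists n; rewrite e.
case: (ex_minnP ex) => n /eqP yn nmin.
have kn : (k < n)%N.
  rewrite ltnNge; apply: contra yk => nk.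
  by rewrite -(subnKC nk) expnD mulrnA yn mul0rn.
case: n kn yn nmin => // n kn yn nmin; exists n => //; split=> //.
by apply/negP => /nmin; rewrite ltnn.
Qed.

Lemma multiples_order (k : nat) (y z : V) : y *+ p ^ k != 0 ->
  z *+ p ^ k.+1 = 0 -> multiples y z.
Proof.
move=> /exact_order[j kj [yj yj1]] zk; apply: multiples_exact_order yj yj1 _.
by rewrite -(subnKC (kj : k.+1 <= j.+1)%N) expnD mulrnA zk mul0rn.
Qed.

(** The gcd of [a] and [p ^ k.+1] kills [y] and is a power of [p]; a proper divisor of [p ^ k.+1]
    would make [p ^ k] kill [y]. *)
Lemma order_dvdz (k : nat) (y : V) (a : int) : y *+ p ^ k != 0 ->
  y *+ p ^ k.+1 = 0 -> y *~ a = 0 -> ((p ^ k.+1)%N %| a)%Z.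
Proof.
move=> yk yk1 ya; have yk1' : y *~ (p ^ k.+1)%N = 0 by rewrite -pmulrn.
have [u] := Bezout_mulrz a yk1'; rewrite ya mul0rz => /esym.
have : (gcdz a (p ^ k.+1)%N %| a)%Z by apply: dvdz_gcdl.
rewrite /gcdz absz_nat.
have /(dvdn_pfactor _ _ pp)[i ik ->] : (gcdn `|a| (p ^ k.+1) %| p ^ k.+1)%N by apply: dvdn_gcdr.
move: ik; rewrite leq_eqVlt => /orP[/eqP -> //|]; rewrite ltnS => ik _.
rewrite -pmulrn => yi; move: yk; rewrite -(subnKC ik) expnD mulrnA yi mul0rn eqxx //.
Qed.

Lemma bounded_cyclic (N : nat) : (forall y : V, y *+ p ^ N = 0) ->
  exists n (g : V), [/\ g *+ p ^ n != 0, g *+ p ^ n.+1 = 0 & forall y, multiples g y].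
Proof.
move=> VN; have ex : exists n, `[< forall y : V, y *+ p ^ n = 0 >] by exists N; apply/asboolP.
case: (ex_minnP ex) => -[|n] /asboolP Vn nmin.
  by move: (x0); rewrite -[x]mulr1n -(expn0 p) Vn eqxx.
have [g gn] : exists g : V, g *+ p ^ n != 0.
  apply: contrapT => h; suff /nmin : `[< forall y : V, y *+ p ^ n = 0 >] by rewrite ltnn.
  by apply/asboolP => y; apply/eqP; apply: contra_notT h => yn; exists y.
by exists n, g; split=> // y; apply: multiples_order gn (Vn y).
Qed.

(** If [p ^ k] kills [y], take [z] not killed by [p ^ k.+1]: the order of [z *+ p] still exceeds
    [p ^ k], so [y] is a multiple of [z *+ p]. *)
Lemma unbounded_divisible : (forall N, exists y : V, y *+ p ^ N != 0) ->
  forall y : V, exists w, w *+ p = y.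
Proof.
move=> Vu y; have [k yk] := Vp y; have [z zk] := Vu k.+1.
have [||a ->] := @multiples_order k (z *+ p) y; first by rewrite -mulrnA -expnS.
  by rewrite expnSr mulrnA yk mul0rn.
by exists (z *~ a); rewrite !pmulrn -!mulrzA mulrC.
Qed.

(** Start from [x] and divide by [p] repeatedly. The index is shifted so that [g k] has order
    exactly [p ^ k], as 1 / p^k has in the Pruefer group. *)
Lemma divisible_sequence : (forall y : V, exists w, w *+ p = y) ->
  exists g : nat -> V, [/\ g 0%N = 0, forall k, g k.+1 *+ p = g k,
    forall k a, g k *~ a = 0 -> ((p ^ k)%N %| a)%Z &
    forall y, exists k, multiples (g k) y].
Proof.
move=> /choice[h hp]; pose g k := if k is l.+1 then iter l h x else 0.
have gS k : g k.+1 *+ p = g k by case: k => [//|k] /=; rewrite hp.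
have gp k : g k.+1 *+ p ^ k = x.
  by elim: k => [|k IH]; rewrite ?expn0 ?mulr1n // expnS mulrnA gS.
have gp1 k : g k *+ p ^ k = 0.
  by case: k => [|k]; rewrite ?mul0rn // expnSr mulrnA gp.
exists g; split=> // [[|k] a|y].
- by rewrite expn0 dvd1z.
- by apply: order_dvdz; rewrite ?gp ?gp1.
have [k yk] := Vp y; exists k.+1; apply: (@multiples_order k); rewrite ?gp //.
by rewrite expnSr mulrnA yk mul0rn.
Qed.

End Cocyclic.

(** * Cyclic groups, Pruefer groups and vector spaces over the prime field *)

Lemma isomorphic_multiples_chain (M N : lmodType int) : isomorphic M N ->
  (forall x y : N, multiples x y \/ multiples y x) ->
  forall x y : M, multiples x y \/ multiples y x.
Proof.
move=> [f /bij_inj fi] Nc x y.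
have back u v : multiples (f u) (f v) -> multiples u v.
  by case=> a ea; exists a; apply: fi; rewrite raddfMz.
by have [/back|/back] := Nc (f x) (f y); [left|right].
Qed.

Lemma isomorphic_order_p (M N : lmodType int) (p : nat) (y : N) : isomorphic M N ->
  y != 0 -> y *+ p = 0 -> exists2 x : M, x != 0 & x *+ p = 0.
Proof.
move=> [f [g fK gK]] y0 yp; exists (g y).
  by apply: contra_neq y0 => e; rewrite -[y]gK e raddf0.
by apply: (can_inj fK); rewrite raddfMn /= gK yp raddf0.
Qed.

Lemma Zp_intr_eq0 (m : nat) (a : int) : (1 < m)%N ->
  (a%:~R == 0 :> 'Z_m) = (m %| a)%Z.
Proof.
move=> m1; have natE (n : nat) : (n%:R == 0 :> 'Z_m) = (m %| n)%N.
  by rewrite Zp_nat -val_eqE /= Zp_cast.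
by case: a => n; rewrite ?NegzE ?mulrNz ?oppr_eq0 -pmulrn natE // dvdzE abszN.
Qed.

Lemma Zp_intr_surj (m : nat) (q : 'Z_m) : exists a : int, q = a%:~R.
Proof. by exists (q : nat)%:Z; rewrite -pmulrn natr_Zp. Qed.

Section Cyclic.
Variables (p n : nat).
Hypotheses (pp : prime p) (n0 : (0 < n)%N).

Lemma pexp_gt1 : (1 < p ^ n)%N.
Proof. by rewrite -(exp1n n) ltn_exp2r // prime_gt1. Qed.

Lemma Zp_multiples_chain (x y : 'Z_(p ^ n)) : multiples x y \/ multiples y x.
Proof.
have [a ->] := Zp_intr_surj x; have [b ->] := Zp_intr_surj y.
apply: (@cyclic_multiples_chain _ p n) => //.
by rewrite pchar_Zp // pexp_gt1.
Qed.

Lemma Zp_order_p : exists2 y : 'Z_(p ^ n), y != 0 & y *+ p = 0.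
Proof.
exists (p ^ n.-1)%:R; last by rewrite -mulrnA -expnSr prednK // pchar_Zp // pexp_gt1.
have -> : (p ^ n.-1)%:R = (p ^ n.-1)%N%:~R :> 'Z_(p ^ n) by rewrite -pmulrn.
rewrite Zp_intr_eq0 ?pexp_gt1 // dvdzE /= dvdn_Pexp2l ?prime_gt1 //.
by rewrite -ltnNge prednK.
Qed.

End Cyclic.

(** The graph pairs [g *~ a] with the class of [a]; both kernels are trivial because [g] has order
    exactly [p ^ n.+1]. *)
Lemma isomorphic_Zp (M : lmodType int) (p n : nat) (g : M) : prime p ->
  g *+ p ^ n != 0 -> g *+ p ^ n.+1 = 0 -> (forall y, multiples g y) ->
  isomorphic M (zmodule 'Z_(p ^ n.+1)).
Proof.
move=> pp gn gn1 gM.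
pose G (y : M) (q : zmodule 'Z_(p ^ n.+1)) :=
  exists a : int, y = g *~ a /\ q = a%:~R :> 'Z_(p ^ n.+1).
have p1 := pexp_gt1 pp (ltn0Sn n).
apply: (@isomorphic_of_graph _ _ G).
- by move=> _ _ _ _ [a [-> ->]] [b [-> ->]]; exists (a - b); rewrite !mulrzBr.
- by move=> y; have [a ->] := gM y; exists (a%:~R : 'Z_(p ^ n.+1)), a.
- by move=> q; have [a e] := Zp_intr_surj q; exists (g *~ a), a.
- move=> q [a [/esym /(order_dvdz pp gn gn1) pa ->]].
  by apply/eqP; rewrite Zp_intr_eq0.
- move=> y [a [-> /esym/eqP]]; rewrite Zp_intr_eq0 //.
  exact: mulrz_dvd0.
Qed.

(** * The Pruefer group as fractions a / p^k modulo the integers *)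

Section Prufer.
Variable p : nat.
Hypothesis pp : prime p.

Lemma pexp_neq0 (k : nat) : (p ^ k)%:R != 0 :> rat.
Proof. by rewrite natrX expf_neq0 // pnatr_eq0 -lt0n prime_gt0. Qed.

Lemma zinv_frac_subproof (a : int) (k : nat) : a%:~R / (p ^ k)%:R \in zinv_pred p.
Proof.
rewrite unfold_in /zinv_pred.
apply: (@pnat_dvd _ (p ^ k)); last by rewrite pnatX pnat_id.
have pk0 : ((p ^ k)%N : int) != 0.
  by have := pexp_neq0 k; rewrite pmulrn intr_eq0.
rewrite pmulrn -[X in (_ %| X)%N]absz_nat.
case: (divqP a (p ^ k)%N) pk0 => [_ /eqP //|c r c0 _].
by rewrite abszM dvdn_mull.
Qed.

Definition zinv_frac (a : int) (k : nat) : zinv p :=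
  exist (fun x : rat => x \in zinv_pred p) _ (zinv_frac_subproof a k).

Lemma zinv_fracB (a b : int) (k : nat) :
  zinv_frac a k - zinv_frac b k = zinv_frac (a - b) k.
Proof. by apply/val_inj; rewrite raddfB /= -mulrBl rmorphB. Qed.

Lemma zinv_fracD (a : int) (k l : nat) :
  zinv_frac a k = zinv_frac (a * (p ^ l)%N) (k + l).
Proof.
apply/val_inj; rewrite /= expnD natrM rmorphM /= -pmulrn -mulf_div divff ?mulr1 //.
exact: pexp_neq0.
Qed.

Lemma zinv_fracP (r : zinv p) : exists a k, r = zinv_frac a k.
Proof.
have /p_natP[k ek] := valP r : p.-nat `|denq (val r)|%N.
exists (numq (val r)), k; apply/val_inj => /=.
rewrite -[LHS]divq_num_den; congr (_ / _).
by rewrite pmulrn -ek absz_denq.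
Qed.

Lemma zinv_frac_int (a : int) (k : nat) :
  (val (zinv_frac a k) \is a Num.int) = ((p ^ k)%N %| a)%Z.
Proof.
apply/intrP/dvdzP => /= [[m em]|[m ->]]; exists m.
  apply/eqP; rewrite -(eqr_int rat) rmorphM /= -em -pmulrn divfK //.
  exact: pexp_neq0.
by rewrite rmorphM /= -pmulrn mulfK // pexp_neq0.
Qed.

Definition prufer_frac (a : int) (k : nat) : prufer p := \pi_(prufer p) (zinv_frac a k).

Lemma prufer_fracB (a b : int) (k : nat) :
  prufer_frac a k - prufer_frac b k = prufer_frac (a - b) k.
Proof. by rewrite /prufer_frac -zinv_fracB raddfB. Qed.

Lemma prufer_fracD (a : int) (k l : nat) :
  prufer_frac a k = prufer_frac (a * (p ^ l)%N) (k + l).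
Proof. by rewrite /prufer_frac -zinv_fracD. Qed.

Lemma prufer_fracP (q : prufer p) : exists a k, q = prufer_frac a k.
Proof.
have [a [k e]] := zinv_fracP (repr q).
by exists a, k; rewrite /prufer_frac -e reprK.
Qed.

Lemma prufer_frac_eq0 (a : int) (k : nat) :
  (prufer_frac a k == 0) = ((p ^ k)%N %| a)%Z.
Proof.
rewrite -zinv_frac_int -[RHS]/(zinv_frac a k \in @zinv_int p).
rewrite -[zinv_frac a k in RHS]subr0 Quotient.idealrBE raddf0 //.
Qed.

Lemma prufer_fracMz (a b : int) (k : nat) :
  prufer_frac a k *~ b = prufer_frac (a * b) k.
Proof.
rewrite /prufer_frac -raddfMz; congr (\pi _); apply/val_inj.
by rewrite raddfMz /= rmorphM /= -mulrzl mulrCA mulrA mulrC mulrA.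
Qed.

(** Over a common denominator both elements are multiples of 1 / p^(k + l), which generates a cyclic
    p-group. *)
Lemma prufer_multiples_chain (x y : prufer p) : multiples x y \/ multiples y x.
Proof.
have [a [k ->]] := prufer_fracP x; have [b [l ->]] := prufer_fracP y.
rewrite (prufer_fracD a k l) (prufer_fracD b l k) [(l + k)%N]addnC.
rewrite -[_ * _]mul1r -[b * _]mul1r -!prufer_fracMz.
apply: (@cyclic_multiples_chain _ p (k + l)) => //.
apply/eqP; rewrite pmulrn prufer_fracMz prufer_frac_eq0 mul1r //.
Qed.

Lemma prufer_order_p : exists2 y : prufer p, y != 0 & y *+ p = 0.
Proof.
exists (prufer_frac 1 1).
  by rewrite prufer_frac_eq0 expn1 dvdzE /= dvdn1 neq_ltn prime_gt1 ?orbT.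
by apply/eqP; rewrite pmulrn prufer_fracMz prufer_frac_eq0 expn1 mul1r.
Qed.

(** [g k] plays the role of 1 / p^k: the graph pairs [g k *~ a] with a / p^k, and differences are
    taken over a common denominator. *)
Lemma isomorphic_prufer (M : lmodType int) (g : nat -> M) :
  g 0%N = 0 -> (forall k, g k.+1 *+ p = g k) ->
  (forall k a, g k *~ a = 0 -> ((p ^ k)%N %| a)%Z) ->
  (forall y, exists k, multiples (g k) y) ->
  isomorphic M (zmodule (prufer p)).
Proof.
move=> g0 gS gi gs.
have gD k l : g (k + l)%N *+ p ^ l = g k.
  elim: l => [|l IH]; first by rewrite addn0 expn0.
  by rewrite addnS expnS mulrnA gS.
pose G (y : M) (q : zmodule (prufer p)) :=
  exists a k, y = g k *~ a /\ q = prufer_frac a k :> prufer p.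
apply: (@isomorphic_of_graph _ _ G).
- move=> _ _ _ _ [a [k [-> ->]]] [b [l [-> ->]]].
  exists (a * (p ^ l)%N - b * (p ^ k)%N), (k + l)%N; split.
    rewrite mulrzBr [a * _]mulrC [b * _]mulrC !mulrzA -!pmulrn gD.
    by rewrite [(k + l)%N]addnC gD.
  by rewrite -prufer_fracB -prufer_fracD [(k + l)%N]addnC -prufer_fracD.
- by move=> y; have [k [a ->]] := gs y; exists (prufer_frac a k), a, k.
- by move=> q; have [a [k e]] := prufer_fracP q; exists (g k *~ a), a, k.
- move=> q [a [k [/esym /gi pa ->]]].
  by apply/eqP; rewrite prufer_frac_eq0.
- move=> y [a [k [-> /esym/eqP]]]; rewrite prufer_frac_eq0.
  by apply: mulrz_dvd0; have := gD 0%N k; rewrite g0.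
Qed.

End Prufer.

(** * Vector spaces over the prime field *)

Section Elementary.
Variable p : nat.
Hypothesis pp : prime p.

Lemma malg_order_p (I : choiceType) (i : I) :
  exists2 y : {malg 'Z_p[I]}, y != 0 & y *+ p = 0.
Proof.
exists << 1 *g i >>; first by rewrite monalgU_eq0 oner_eq0.
by rewrite -monalgUMn pchar_Zp ?prime_gt1 // monalgU0.
Qed.

Lemma malg_mulrn_p (I : choiceType) (y : {malg 'Z_p[I]}) : y *+ p = 0.
Proof.
apply/malgP => i; rewrite mcoeffMn mcoeff0 -mulr_natr pchar_Zp ?prime_gt1 //.
exact: mulr0.
Qed.

Variable V : zmodType.
Hypothesis Vp : forall x : V, x *+ p = 0.

(** As [p] kills [V], multiplying by the natural representative of a class in ['Z_p] is the scalar
    action of the prime field. *)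
Lemma mulrn_Zp (x : V) (n : nat) : x *+ (n%:R : 'Z_p) = x *+ n.
Proof.
rewrite val_Zp_nat ?prime_gt1 // [in RHS](divn_eq n p) mulrnDr.
by rewrite mulnC mulrnA Vp mul0rn add0r.
Qed.

Lemma mulrn_ZpD (x : V) (a b : 'Z_p) : x *+ (a + b)%R = x *+ a + x *+ b.
Proof. by rewrite -[a]natr_Zp -[b]natr_Zp -natrD !mulrn_Zp mulrnDr. Qed.

Lemma mulrn_ZpM (x : V) (a b : 'Z_p) : x *+ (a * b)%R = x *+ a *+ b.
Proof. by rewrite -[a]natr_Zp -[b]natr_Zp -natrM !mulrn_Zp mulrnA. Qed.

(** The linear map from the free module on [I] determined by the family [v]. *)
Definition lincomb (I : choiceType) (v : I -> V) (q : {malg 'Z_p[I]}) : V :=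
  \sum_(i <- msupp q) v i *+ q@_i.

Lemma lincombEw (I : choiceType) (v : I -> V) (q : {malg 'Z_p[I]}) (d : {fset I}) :
  (msupp q `<=` d)%fset -> lincomb v q = \sum_(i <- d) v i *+ q@_i.
Proof.
move=> qd; rewrite /lincomb (big_fset_incl _ qd) // => i _ iq.
by rewrite mcoeff_outdom.
Qed.

Lemma lincombD (I : choiceType) (v : I -> V) (q r : {malg 'Z_p[I]}) :
  lincomb v (q + r) = lincomb v q + lincomb v r.
Proof.
rewrite (lincombEw v (msuppD_le q r)) (lincombEw v (fsubsetUl (msupp q) (msupp r))).
rewrite (lincombEw v (fsubsetUr (msupp q) (msupp r))) -big_split /=.
by apply: eq_bigr => i _; rewrite mcoeffD mulrn_ZpD.
Qed.

Lemma lincombB (I : choiceType) (v : I -> V) (q r : {malg 'Z_p[I]}) :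
  lincomb v (q - r) = lincomb v q - lincomb v r.
Proof. by apply/eqP; rewrite eq_sym subr_eq -lincombD subrK. Qed.

Lemma lincombU (I : choiceType) (v : I -> V) (c : 'Z_p) (i : I) :
  lincomb v << c *g i >> = v i *+ c.
Proof. by rewrite (lincombEw v msuppU_le) big_seq_fset1 mcoeffUU. Qed.

Definition independent (B : set V) : Prop :=
  forall (s : seq V) (c : V -> 'Z_p), uniq s -> (forall x, x \in s -> B x) ->
    \sum_(x <- s) x *+ c x = 0 -> forall x, x \in s -> c x = 0.

Lemma independent_bigcup (F : set (set V)) : F `<=` independent ->
  total_on F subset -> independent (\bigcup_(X in F) X).
Proof.
(* A nonempty finite list from the union lies in one member of the chain; the empty list is set
   apart because the chain may be empty. *)
move=> Fi FT s c us sF; have [->//|sn] := eqVneq s [::].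
have [X FX sX] : exists2 X, F X & forall x, x \in s -> X x.
  elim: s {us} sn sF => // x [|y s] IH _ sF.
    by have [X FX Xx] := sF x (mem_head _ _); exists X => // z; rewrite inE => /eqP->.
  have [//||X FX sX] := IH; first by move=> z zs; apply: sF; rewrite inE zs orbT.
  have [Y FY Yx] := sF x (mem_head _ _).
  have [XY|YX] := FT _ _ FX FY.
    by exists Y => // z; rewrite inE => /orP[/eqP->//|/sX/XY].
  by exists X => // z; rewrite inE => /orP[/eqP->|/sX//]; apply: YX.
exact: Fi FX s c us sX.
Qed.

Lemma exists_basis : exists2 B : set V, independent B &
  forall x : V, ~ B x -> exists (s : seq V) (c : V -> 'Z_p),
    (forall y, y \in s -> B y) /\ x = \sum_(y <- s) y *+ c y.
Proof.
have [B [Bi Bmax]] := Zorn_bigcup independent_bigcup.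
exists B => // x nBx; have : ~ independent (B `|` [set x]).
  apply: Bmax; split; first by move=> y By; left.
  by move=> /(_ x) h; apply/nBx/h; right.
move/existsNP => [s /existsNP[c /not_implyP[us /not_implyP[sB /not_implyP[e]]]]].
move/existsNP => [y /not_implyP[ys cy]].
(* The nontrivial relation must involve [x] with a nonzero coefficient, since otherwise it would be
   a relation within [B]. *)
have [xs|xs] := boolP (x \in s); last first.
  case: cy; apply: Bi us _ e y ys => z zs; case: (sB _ zs) => //= zx.
  by rewrite -zx zs in xs.
have sB' z : z \in rem x s -> B z.
  rewrite mem_rem_uniq // inE => /andP[zx zs].
  by case: (sB _ zs) zx => // ->; rewrite eqxx.
move: e; rewrite (big_rem x xs) /= => /eqP; rewrite addr_eq0 => /eqP e.
have [cx|cx] := eqVneq (c x) 0.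
  case: cy; have [->//|yx] := eqVneq y x.
  apply: (Bi (rem x s) c (rem_uniq _ us) sB'); last by rewrite mem_rem_uniq // inE yx.
  by apply/eqP; rewrite -oppr_eq0 -e cx.
have cxu : c x \is a GRing.unit.
  rewrite -[c x]natr_Zp unitZpE ?prime_gt1 // prime_coprime // gtnNdvd ?lt0n //.
  by rewrite -[X in (_ < X)%N](Zp_cast (prime_gt1 pp)).
(* Solve the relation for [x], dividing by its coefficient. *)
exists (rem x s), (fun z => c z * - (c x)^-1); split=> //.
under eq_bigr do rewrite mulrn_ZpM.
rewrite sumrMnl -[LHS](mulrn_Zp x 1) -[1%:R](divrr cxu) mulrn_ZpM e mulNrn.
apply/eqP; rewrite eq_sym -subr_eq0 opprK -mulrn_ZpD addNr.
by rewrite -[0 : 'Z_p]/(0%:R) mulrn_Zp.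
Qed.

End Elementary.

(** The graph is that of [lincomb] over a basis, read backwards: spanning makes it total and
    independence makes the kernel of [lincomb] trivial. *)
Lemma isomorphic_malg (M : lmodType int) (p : nat) : prime p ->
  (forall x : M, x *+ p = 0) ->
  exists I : choiceType, isomorphic M (zmodule {malg 'Z_p[I]}).
Proof.
move=> pp Mp; have [B Bi Bspan] := exists_basis pp Mp.
pose I : choiceType := {x : M | `[< B x >]}; exists I.
pose v (i : I) : M := val i.
have Pc : is_subgroup [set y | exists q : {malg 'Z_p[I]}, y = lincomb v q].
  split; last by move=> _ _ [q ->] [r ->]; exists (q - r); rewrite lincombB.
  by exists 0; rewrite /lincomb msupp0 big_seq_fset0.
have PB x : B x -> exists q : {malg 'Z_p[I]}, x = lincomb v q.
  move=> /asboolP Bx; exists << 1 *g (exist _ x Bx : I) >>.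
  by rewrite lincombU // -[1 : 'Z_p]/(1%:R) mulrn_Zp.
pose G (y : M) (q : zmodule {malg 'Z_p[I]}) := y = lincomb v q.
apply: (@isomorphic_of_graph _ _ G).
- by move=> _ q _ r -> ->; rewrite /G lincombB.
- move=> y; have [/PB//|/Bspan[s [c [sB ->]]]] := pselect (B y).
  rewrite big_seq; elim/big_ind: _; first exact: Pc.1.
    by move=> a b Pa Pb; apply: (subgroupD Pc).
  by move=> x /sB Bx; apply: (subgroupMn Pc); apply: PB.
- by move=> q; exists (lincomb v q).
(* [c] extends the coefficients of [q] by 0 outside [B], since [independent] takes coefficient
   functions on the whole space. *)
- move=> q /esym q0; pose c x := if insub x is Some i then q@_(i : I) else 0.
  have cv i : c (v i) = q@_i by rewrite /c /v valK.
  apply/malgP => i; rewrite mcoeff0.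
  have [iq|iq] := boolP (i \in msupp q); last by rewrite mcoeff_outdom.
  rewrite -cv; apply: (Bi [seq v j | j <- msupp q] c).
  + by rewrite map_inj_uniq //; apply: val_inj.
  + by move=> _ /mapP[j _ ->]; apply/asboolP; exact: (valP j).
  + by rewrite big_map -[RHS]q0; apply: eq_bigr => j _; rewrite cv.
  + exact: map_f.
- by move=> y ->; rewrite /lincomb msupp0 big_seq_fset0.
Qed.

(** * Both directions of the classification *)

Theorem proposition5p8 (M : lmodType int) :
  weakly_uniserial M /\ socle M <> [set 0] <->
  exists2 p : nat, prime p &
    [\/ exists2 n : nat, (1 <= n)%N & isomorphic M (zmodule 'Z_(p ^ n)),
        isomorphic M (zmodule (prufer p)) |
        exists2 I : choiceType, inhabited I &
          isomorphic M (zmodule {malg 'Z_p[I]})].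
Proof.
split=> [[Mw Ms]|[p pp [[n n0 Miso]|Miso|[I [i] Miso]]]]; last first.
- have [y y0 yp] := malg_order_p pp i.
  have [x x0 xp] := isomorphic_order_p Miso y0 yp.
  split; last exact: order_p_socle pp x0 xp.
  apply: (elementary_weakly_uniserial pp) => z; have [f /bij_inj fi] := Miso.
  by apply: fi; rewrite raddfMn raddf0; apply: malg_mulrn_p pp _ _.
- have [y y0 yp] := prufer_order_p pp.
  have [x x0 xp] := isomorphic_order_p Miso y0 yp.
  split; last exact: order_p_socle pp x0 xp.
  apply/chain_weakly_uniserial/(isomorphic_multiples_chain Miso).
  exact: prufer_multiples_chain.
- have [y y0 yp] := Zp_order_p pp n0.
  have [x x0 xp] := isomorphic_order_p Miso y0 yp.
  split; last exact: order_p_socle pp x0 xp.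
  apply/chain_weakly_uniserial/(isomorphic_multiples_chain Miso).
  exact: Zp_multiples_chain.
have [p [x [pp x0 xp]]] := socle_order_p Ms; exists p => //.
have Mtors := p_torsion Mw pp x0 xp.
have [Mp|nMp] := pselect (forall y : M, y *+ p = 0).
  constructor 3; have [I Miso] := isomorphic_malg pp Mp; exists I => //.
  (* Over an empty index set the free module is zero, whereas [x] is not. *)
  apply: contrapT => nI; have [f fb] := Miso.
  move/eqP: x0; apply; apply: (bij_inj fb); rewrite raddf0.
  by apply/malgP => i; case: nI.
(* An element of order [p ^ j.+1] with [j] at least 1, multiplied by [p ^ j.-1], has order
   [p ^ 2]. *)
have [u up0 upp] : exists2 u : M, u *+ p != 0 & u *+ p *+ p = 0.
  move/existsNP: nMp => [y /eqP yp].
  rewrite -[p]expn1 in yp; have [j j1 [yj yj1]] := exact_order Mtors yp.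
  exists (y *+ p ^ j.-1); first by rewrite -mulrnA -expnSr prednK.
  by rewrite -!mulrnA mulnA -!expnSr prednK.
(* From here on [u *+ p] is the generator of the p-torsion. *)
have Mu := p_torsion_part_cyclic Mw pp up0 upp.
have [[N MN]|nbd] := pselect (exists N, forall y : M, y *+ p ^ N = 0).
  constructor 1; have [n [g [gn gn1 gM]]] := bounded_cyclic pp up0 upp Mtors Mu MN.
  by exists n.+1 => //; apply: isomorphic_Zp pp gn gn1 gM.
constructor 2.
have Mdiv : forall y : M, exists w, w *+ p = y.
  apply: (unbounded_divisible pp upp Mtors Mu) => N.
  apply: contrapT => nex; apply: nbd; exists N => y; apply/eqP.
  by apply: contra_notT nex => yN; exists y.
have [g [g0 gS gi gs]] := divisible_sequence pp up0 upp Mtors Mu Mdiv.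
exact: (isomorphic_prufer pp g0 gS gi gs).
Qed.
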